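(* Let $i \ge 0$ be an integer and let $n$ be a non-negative integer with $n \le 2^i$. For each $\ell \ge 0$, let $b_0(n,i,\ell)$ be the number of $i$-bit BSD representations of $n$ that have exactly $\ell$ digits equal to $0$ (and thus have Hamming weight $i-\ell$). Then $$B_{2^i-n}(t)=\sum_{\ell \ge 0} b_0(n,i,\ell)\, t^\ell .$$
   Context: The Stern polynomials $B_n(t)\in\mathbb{Z}[t]$, $n\ge 0$, are defined by $B_0=0$, $B_1=1$, $B_{2n}=t\,B_n$, $B_{2n+1}=B_n+B_{n+1}$. An $i$-bit binary signed-digit (BSD) representation of an integer $n$ is a string of digits $(b_{i-1}\cdots b_0)$ with each $b_j\in\{1,0,-1\}$ such that $n=\sum_{j=0}^{i-1} b_j 2^j$. Its Hamming weight is the number of nonzero digits. *)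

(* Defs.v *)
From mathcomp Require Import all_boot all_order all_algebra.

Set Implicit Arguments.
Unset Strict Implicit.
Unset Printing Implicit Defensive.

Import Order.TTheory GRing.Theory Num.Theory.
Local Open Scope ring_scope.

(* The argument k only bounds the recursion depth; any k >= n gives the same
   value (stern_rec_fuel). The defining recurrences of the Stern polynomials
   are the lemmas stern0, stern1, stern_double and stern_doubleS. *)
Fixpoint stern_rec (k n : nat) : {poly int} :=
  if k is k'.+1 then
    if (n <= 1)%N then n%:R
    else if odd n then stern_rec k' n./2 + stern_rec k' n./2.+1
    else 'X * stern_rec k' n./2
  else 0.

Definition stern (n : nat) : {poly int} := stern_rec n n.

Lemma stern_rec_fuel (k n : nat) : (n <= k)%N -> stern_rec k n = stern n.
Proof.
suff H m k1 k2 : (m <= k1)%N -> (m <= k2)%N -> stern_rec k1 m = stern_rec k2 m.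
  by move=> le_nk; apply: H.
elim: k1 k2 m => [|k1 IH] [|k2] m //=; rewrite ?leqn0.
- by move=> /eqP->.
- by move=> _ /eqP->.
move=> le1 le2; case: leqP => // gt1.
have hlt : (m./2 < m)%N by rewrite -divn2 ltn_Pdiv // ltnW.
have h1 : (m./2 <= k1)%N by rewrite -ltnS (leq_trans hlt).
have h2 : (m./2 <= k2)%N by rewrite -ltnS (leq_trans hlt).
case: ifP => [om|_]; last by rewrite (IH k2).
have hSlt : (m./2.+1 < m)%N.
  have def_m := odd_double_half m; rewrite om add1n in def_m.
  rewrite -[X in (_ < X)%N]def_m ltnS -addnn -[X in (X < _)%N]addn0 ltn_add2l.
  by rewrite half_gt0.
by rewrite (IH k2 m./2) // (IH k2 m./2.+1) // -ltnS (leq_trans hSlt).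
Qed.

Lemma stern0 : stern 0 = 0. Proof. by []. Qed.

Lemma stern1 : stern 1 = 1. Proof. by []. Qed.

Lemma stern_recS (k n : nat) : (1 < n)%N ->
  stern_rec k.+1 n = if odd n then stern_rec k n./2 + stern_rec k n./2.+1
                     else 'X * stern_rec k n./2.
Proof. by move=> /=; case: leqP. Qed.

Lemma stern_double (n : nat) : stern n.*2 = 'X * stern n.
Proof.
case: n => [|n]; first by rewrite mulr0.
rewrite -(@stern_rec_fuel n.+1.*2.+1) // stern_recS // odd_double doubleK.
by rewrite stern_rec_fuel // -addnn leq_addr.
Qed.

Lemma stern_doubleS (n : nat) : stern n.*2.+1 = stern n + stern n.+1.
Proof.
case: n => [|n]; first by rewrite stern0 add0r.
have le_n : (n.+1 <= n.+1.*2)%N by rewrite -addnn leq_addr.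
rewrite -(@stern_rec_fuel n.+1.*2.+2) // stern_recS // oddS odd_double.
rewrite (_ : n.+1.*2.+1./2 = n.+1) ?(half_bit_double n.+1 true) // [~~ _]/=.
by rewrite !stern_rec_fuel // leqW.
Qed.

Notation bsd_digit := (seq_sub [:: 1; 0; -1 : int]).

(* A digit string (b_(i-1) ... b_0) is the function j |-> b_j on positions,
   so that b j has weight 2^j. *)
Definition bsd_value (i : nat) (b : {ffun 'I_i -> bsd_digit}) : int :=
  \sum_(j < i) val (b j) * 2 ^+ j.

Definition bsd_zeros (i : nat) (b : {ffun 'I_i -> bsd_digit}) : nat :=
  #|[set j : 'I_i | val (b j) == 0]|.

Definition bsd_reprs (i : nat) (n : int) : {set {ffun 'I_i -> bsd_digit}} :=
  [set b | bsd_value b == n].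

Definition bsd_count0 (n : int) (i l : nat) : nat :=
  #|[set b in bsd_reprs i n | bsd_zeros b == l]|.

Lemma bsd_count0_gt (n : int) (i l : nat) : (i < l)%N -> bsd_count0 n i l = 0%N.
Proof.
move=> lt_il; apply/eqP; rewrite cards_eq0; apply/eqP/setP => b.
rewrite !inE; apply/negbTE; rewrite negb_and; apply/orP; right.
rewrite neq_ltn; apply/orP; left; apply: leq_ltn_trans lt_il.
by rewrite (leq_trans (max_card _)) ?card_ord.
Qed.

(* Main.v *)
Require Import Defs.
From mathcomp Require Import all_boot all_order all_algebra.
From mathcomp Require Import zify.

Import Order.TTheory GRing.Theory Num.Theory.
Local Open Scope ring_scope.

(** Let G_i(n) be the sum of t^(number of zeros) over the i-bit BSD
    representations of n. Splitting off the lowest digit, whose parity is that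
    of n, gives G_(i+1)(2m) = t G_i(m) and G_(i+1)(2m+1) = G_i(m) + G_i(m+1).
    The polynomials B_(2^i-n) satisfy the same recurrences in (i, n). *)

(** Lets a sum over the finite type [bsd_digit] be expanded into its three explicit terms with
    [big_cons]. *)
Lemma sum_seq_sub (T : choiceType) (V : nmodType) (s : seq T) (F : T -> V) :
  uniq s -> \sum_(x : seq_sub s) F (val x) = \sum_(x <- s) F x.
Proof.
move=> s_uniq; rewrite -(big_map val xpredT F); apply: perm_big.
apply: uniq_perm => //.
  by rewrite (map_inj_uniq val_inj) index_enum_uniq.
move=> x; apply/mapP/idP => [[y _ ->]|xs]; first exact: valP.
by exists (SeqSub xs); rewrite ?mem_index_enum.
Qed.

(** The new entry sits at position 0, so it becomes the lowest digit and all other digits double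
    their weight. *)
Definition ffun_cons {T : Type} {i : nat} (p : T * {ffun 'I_i -> T}) :
    {ffun 'I_i.+1 -> T} :=
  [ffun j => if unlift ord0 j is Some k then p.2 k else p.1].

Lemma ffun_cons0 (T : Type) (i : nat) (p : T * {ffun 'I_i -> T}) :
  ffun_cons p ord0 = p.1.
Proof. by rewrite ffunE unlift_none. Qed.

Lemma ffun_cons_lift (T : Type) (i : nat) (p : T * {ffun 'I_i -> T}) j :
  ffun_cons p (lift ord0 j) = p.2 j.
Proof. by rewrite ffunE liftK. Qed.

Lemma ffun_cons_bij (T : Type) (i : nat) : bijective (@ffun_cons T i).
Proof.
exists (fun f : {ffun 'I_i.+1 -> T} =>
          (f ord0, [ffun j : 'I_i => f (lift ord0 j)])) => [[x f]|f].
  rewrite ffun_cons0; congr pair.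
  by apply/ffunP => j; rewrite ffunE ffun_cons_lift.
apply/ffunP => j; case: (unliftP ord0 j) => [k|] ->.
  by rewrite ffun_cons_lift ffunE.
by rewrite ffun_cons0.
Qed.

Lemma bsd_value_cons (i : nat) (p : bsd_digit * {ffun 'I_i -> bsd_digit}) :
  bsd_value (ffun_cons p) = val p.1 + 2 * bsd_value p.2.
Proof.
rewrite /bsd_value big_ord_recl ffun_cons0 expr0 mulr1 mulr_sumr.
by congr (_ + _); apply: eq_bigr => j _; rewrite ffun_cons_lift exprS mulrCA.
Qed.

Lemma bsd_zeros_cons (i : nat) (p : bsd_digit * {ffun 'I_i -> bsd_digit}) :
  bsd_zeros (ffun_cons p) = ((val p.1 == 0) + bsd_zeros p.2)%N.
Proof.
rewrite /bsd_zeros -!sum1dep_card big_mkcond big_ord_recl ffun_cons0.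
congr (_ + _)%N; rewrite [RHS]big_mkcond.
by apply: eq_bigr => j _; rewrite ffun_cons_lift.
Qed.

(** This is $G_i(n)$. *)
Definition bsd_poly (i : nat) (n : int) : {poly int} :=
  \sum_(b : {ffun 'I_i -> bsd_digit} | bsd_value b == n) 'X^(bsd_zeros b).

(** Group the representations by their number of zeros, which is at most [i]. *)
Lemma bsd_polyE (i : nat) (n : int) :
  bsd_poly i n = \sum_(l < i.+1) (bsd_count0 n i l)%:R *: 'X^l.
Proof.
have zeros_lt (b : {ffun 'I_i -> bsd_digit}) : (bsd_zeros b < i.+1)%N.
  by rewrite ltnS (leq_trans (max_card _)) ?card_ord.
rewrite /bsd_poly (partition_big (fun b => Ordinal (zeros_lt b)) xpredT) //=.
apply: eq_bigr => l _; rewrite scaler_nat -sumr_const.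
apply: eq_big => [b|b /andP[_ /eqP <-] //].
by rewrite !inE.
Qed.

Lemma bsd_poly0 (n : int) : bsd_poly 0 n = (n == 0)%:R.
Proof.
rewrite /bsd_poly.
under eq_bigl do rewrite /bsd_value big_ord0 eq_sym.
have zeros0 (b : {ffun 'I_0 -> bsd_digit}) : bsd_zeros b = 0%N.
  by apply/eqP; rewrite -leqn0 (leq_trans (max_card _)) ?card_ord.
under eq_bigr do rewrite zeros0 expr0.
case: (n == 0); last by rewrite big_pred0_eq.
(* Only the empty string is left, and it contributes 1. *)
by rewrite sumr_const card_ffun card_ord expn0.
Qed.

Lemma bsd_polyS (i : nat) (n : int) :
  bsd_poly i.+1 n = \sum_(d <- [:: 1; 0; -1 : int])
    \sum_(b : {ffun 'I_i -> bsd_digit} | d + 2 * bsd_value b == n)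
       'X^((d == 0) + bsd_zeros b).
Proof.
rewrite -sum_seq_sub // pair_big_dep /=.
rewrite /bsd_poly (reindex _ (onW_bij _ (ffun_cons_bij _ i))) /=.
by apply: eq_big => [p|p _]; rewrite ?bsd_value_cons ?bsd_zeros_cons.
Qed.

Lemma bsd_poly_double (i : nat) (m : int) :
  bsd_poly i.+1 (2 * m) = 'X * bsd_poly i m.
Proof.
rewrite bsd_polyS !big_cons big_nil addr0.
(* By parity, the lowest digit of [2 * m] is neither 1 nor -1. *)
rewrite big_pred0 => [|b]; last by apply/negbTE/eqP; lia.
rewrite add0r addrC big_pred0 => [|b]; last by apply/negbTE/eqP; lia.
rewrite add0r mulr_sumr; apply: eq_big => [b|b _]; first by lia.
by rewrite eqxx exprS.
Qed.

Lemma bsd_poly_doubleS (i : nat) (m : int) :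
  bsd_poly i.+1 (2 * m + 1) = bsd_poly i m + bsd_poly i (m + 1).
Proof.
rewrite bsd_polyS !big_cons big_nil addr0.
rewrite [X in _ + (X + _)]big_pred0 => [|b]; last by apply/negbTE/eqP; lia.
(* Lowest digit 1 leaves [m] for the other digits, and -1 leaves [m + 1]; neither adds a zero. *)
by rewrite add0r; congr (_ + _); apply: eq_big => [b|b _] //; lia.
Qed.

Lemma stern_bsd_poly (i n : nat) :
  (n <= 2 ^ i)%N -> stern (2 ^ i - n) = bsd_poly i n%:Z.
Proof.
elim: i n => [|i IH] n.
  (* Only [n = 0] and [n = 1] satisfy the bound, giving $B_1 = 1$ and $B_0 = 0$. *)
  by rewrite expn0 bsd_poly0; case: n => [|[|n]].
rewrite -{1 2 3}(odd_double_half n) expnS; move: n./2 => m.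
case: (odd n) => /= le_n.
  (* Since [2m + 1] is odd and at most $2^{i+1}$, even [m + 1] is at most $2^i$: the truncated
     subtraction is exact and the induction hypothesis applies to both [m] and [m + 1]. *)
  rewrite (_ : (2 * 2 ^ i - _)%N = (2 ^ i - m.+1).*2.+1); last by lia.
  rewrite stern_doubleS (_ : (2 ^ i - m.+1).+1 = 2 ^ i - m)%N; last by lia.
  rewrite !IH; [|lia|lia].
  rewrite addrC (_ : m.+1%:Z = m%:Z + 1); last by lia.
  by rewrite -bsd_poly_doubleS; congr (bsd_poly _ _); lia.
rewrite (_ : (2 * 2 ^ i - _)%N = (2 ^ i - m).*2); last by lia.
rewrite stern_double IH; last by lia.
by rewrite -bsd_poly_double; congr (bsd_poly _ _); lia.
Qed.

Theorem mainTheorem1 (i n : nat) (hn : (n <= 2 ^ i)%N) :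
  stern (2 ^ i - n)%N =
  \sum_(l < i.+1) (bsd_count0 n%:Z i l)%:R *: 'X^l.
Proof. by rewrite stern_bsd_poly // bsd_polyE. Qed.
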